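(* Let $k, l \geq 1$ be natural numbers, and let $\{t_{i,j}\}_{i,j \geq 2}$ be a threshold sequence. For a path $P = \{(a_i,b_i)\}_{i=0, \dots, m}$ in $L$, define $s_1,\dots,s_m$ by \[s_i = \begin{cases} t_{a_i,b_i} & \text{if } (a_i,b_i) = (a_{i-1}, b_{i-1}+1),\\ 1 - t_{a_i,b_i} & \text{if } (a_i,b_i) = (a_{i-1}+1, b_{i-1}),\end{cases}\] and let \[U_{k,l} = \min_{P \in \Pi_{k,l}} \prod_{i=1}^{m} s_i^{a_i}, \qquad V_{k,l} = \min_{P \in \Pi_{k,l}} \prod_{i=1}^{m} s_i^{b_i}\] (an empty product equals $1$). Then there is a constant $A_{k,l}$ (depending on $k,l$ and the threshold sequence) such that for every $n$, in any red/blue-colouring of the edges of $K_n$, there are at least \[U_{k,l} \binom{n}{k} - A_{k,l}\, n^{k-1}\] red copies of $K_k$ or at least \[V_{k,l} \binom{n}{l} - A_{k,l}\, n^{l-1}\] blue copies of $K_l$.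
   Context: Let $L$ be the lattice of integer points $(i,j)$ with $i,j \geq 1$. A path in $L$ to $(k,l)$ is a sequence $P = \{(a_i, b_i)\}_{i=0,\dots,m}$ of points of $L$ such that: $a_0 = 1$ or $b_0=1$; $a_1 \neq 1$ and $b_1 \neq 1$; for each $i\ge 1$, $(a_i, b_i) = (a_{i-1}+1, b_{i-1})$ or $(a_{i-1}, b_{i-1}+1)$; and $(a_m,b_m) = (k,l)$. The set of all paths to $(k,l)$ is denoted $\Pi_{k,l}$. A threshold sequence $\{t_{i,j}\}_{i,j \geq 2}$ is a family of real numbers with $0 < t_{i,j} < 1$ and $t_{j,i} = 1 - t_{i,j}$ for all $i,j\ge 2$. A red copy of $K_k$ is a set of $k$ vertices all of whose pairs are red; similarly for blue; a single vertex counts as both a red and a blue $K_1$. *)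

(* Defs.v *)
From HB Require Import structures.
From mathcomp Require Export all_boot all_order all_algebra.
From mathcomp Require Export boolp classical_sets reals.
From mathcomp Require Import zify.

Set Implicit Arguments.
Unset Strict Implicit.
Unset Printing Implicit Defensive.

Import Order.TTheory GRing.Theory Num.Theory.

Local Open Scope ring_scope.

Section Paths.
Local Open Scope nat_scope.

(* A sequence of points [P] has indices 0, ..., m with m = (size P).-1; its    *)
(* i-th point is (xc P i, yc P i).                                            *)
Definition xc (P : seq (nat * nat)) (i : nat) : nat := (nth (0, 0) P i).1.
Definition yc (P : seq (nat * nat)) (i : nat) : nat := (nth (0, 0) P i).2.

Definition xstep (P : seq (nat * nat)) (i : nat) : bool :=
  (xc P i == (xc P i.-1).+1) && (yc P i == yc P i.-1).
Definition ystep (P : seq (nat * nat)) (i : nat) : bool :=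
  (xc P i == xc P i.-1) && (yc P i == (yc P i.-1).+1).

(* One-point paths (m = 0) are allowed: the condition on the point of index 1 *)
(* is then void. They are the only paths to (k, l) when k = 1 or l = 1.       *)
Record is_path_to (k l : nat) (P : seq (nat * nat)) : Prop := IsPathTo {
  path_nonempty : 0 < size P;
  path_in_lattice : forall i, i < size P -> 1 <= xc P i /\ 1 <= yc P i;
  path_start : xc P 0 = 1 \/ yc P 0 = 1;
  path_leaves : 1 < size P -> xc P 1 <> 1 /\ yc P 1 <> 1;
  path_steps : forall i, 1 <= i < size P -> xstep P i \/ ystep P i;
  path_end : (xc P (size P).-1, yc P (size P).-1) = (k, l)
}.

Definition paths_to (k l : nat) : set (seq (nat * nat)) :=
  [set P | is_path_to k l P]%classic.

End Paths.

Section Weights.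
Variable R : realType.

(* Only the values of [t i j] for i, j >= 2 are meaningful.                   *)
Definition threshold_sequence (t : nat -> nat -> R) : Prop :=
  forall i j : nat, (2 <= i)%N -> (2 <= j)%N ->
    0 < t i j < 1 /\ t j i = 1 - t i j.

Definition path_s (t : nat -> nat -> R) (P : seq (nat * nat)) (i : nat) : R :=
  if ystep P i then t (xc P i) (yc P i) else 1 - t (xc P i) (yc P i).

Definition red_weight (t : nat -> nat -> R) (P : seq (nat * nat)) : R :=
  \prod_(1 <= i < size P) path_s t P i ^+ xc P i.

Definition blue_weight (t : nat -> nat -> R) (P : seq (nat * nat)) : R :=
  \prod_(1 <= i < size P) path_s t P i ^+ yc P i.

(* The least element of S, with junk value 0 if there is none; the lemmas     *)
(* [U_is_min] and [V_is_min] show that the junk value is never used below.    *)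
Definition set_min (S : set R) : R :=
  xget 0 [set x | S x /\ lbound S x]%classic.

Definition U (t : nat -> nat -> R) (k l : nat) : R :=
  set_min [set red_weight t P | P in paths_to k l]%classic.

Definition V (t : nat -> nat -> R) (k l : nat) : R :=
  set_min [set blue_weight t P | P in paths_to k l]%classic.

Lemma paths_to_cover (k l : nat) :
  exists ps : seq (seq (nat * nat)), forall P, paths_to k l P -> P \in ps.
Proof.
suff: exists ps : seq (seq (nat * nat)), forall P, (0 < size P)%N ->
    (forall i, (1 <= i < size P)%N -> xstep P i \/ ystep P i) ->
    nth (0, 0)%N P (size P).-1 = (k, l) -> P \in ps.
  case=> ps Hps; exists ps => P [s0 _ _ _ st].
  rewrite /xc /yc -surjective_pairing; exact: Hps.
move: {2}(k + l)%N (leqnn (k + l)) => N; elim: N k l => [|N IH] k l kl.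
  exists [:: [:: (k, l)]] => P; case/lastP: P => // P q _.
  rewrite size_rcons /= nth_rcons ltnn eqxx => st qE; subst q.
  case: P st => [_|p P st]; first by rewrite mem_head.
  have := st (size P).+1.
  rewrite ltnSn => /(_ isT).
  rewrite /xstep /ystep /xc /yc !nth_rcons /= ltnn eqxx /=.
  by case=> /andP[/eqP ? /eqP ?]; lia.
have [ps1 H1] : exists ps : seq (seq (nat * nat)), forall P, (0 < size P)%N ->
    (forall i, (1 <= i < size P)%N -> xstep P i \/ ystep P i) ->
    (0 < k)%N -> nth (0, 0)%N P (size P).-1 = (k.-1, l) -> P \in ps.
  case: (posnP k) => [->|k0]; first by exists [::].
  have [|ps H] := IH k.-1 l; first lia.
  by exists ps => P ? ? _; apply: H.
have [ps2 H2] : exists ps : seq (seq (nat * nat)), forall P, (0 < size P)%N ->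
    (forall i, (1 <= i < size P)%N -> xstep P i \/ ystep P i) ->
    (0 < l)%N -> nth (0, 0)%N P (size P).-1 = (k, l.-1) -> P \in ps.
  case: (posnP l) => [->|l0]; first by exists [::].
  have [|ps H] := IH k l.-1; first lia.
  by exists ps => P ? ? _; apply: H.
exists ([:: (k, l)] :: map (rcons^~ (k, l)) (ps1 ++ ps2)) => P.
case/lastP: P => // P q _.
rewrite size_rcons /= nth_rcons ltnn eqxx => st qE; subst q.
have [->|Pn0] := eqVneq P [::]; first by rewrite mem_head.
have P0 : (0 < size P)%N by case: (P) Pn0.
rewrite in_cons; apply/orP; right; apply: map_f.
have stP i : (1 <= i < size P)%N -> xstep P i \/ ystep P i.
  move=> iP; have := st i.
  rewrite /xstep /ystep /xc /yc !nth_rcons.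
  have -> : (i < size P)%N by lia.
  have -> : (i.-1 < size P)%N by lia.
  by apply; lia.
have := st (size P); rewrite P0 ltnSn => /(_ isT).
rewrite /xstep /ystep /xc /yc !nth_rcons ltnn eqxx /=.
have -> : ((size P).-1 < size P)%N by lia.
rewrite mem_cat => -[] /andP[/eqP e1 /eqP e2]; apply/orP; [left|right].
- apply: H1 => //; first lia.
  by rewrite [LHS]surjective_pairing; congr (_, _); lia.
- apply: H2 => //; first lia.
  by rewrite [LHS]surjective_pairing; congr (_, _); lia.
Qed.

Lemma paths_to_nonempty (k l : nat) :
  (1 <= k)%N -> (1 <= l)%N -> exists P, paths_to k l P.
Proof.
move=> k1 l1; have [kl|kl] := boolP ((k == 1%N) || (l == 1%N)).
  exists [:: (k, l)]; split=> //=; first by case.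
  - by case/orP: kl => /eqP; [left|right].
  - by case=> // i; rewrite ltnS ltn0 andbF.
have {kl} [k2 l2] : (1 < k)%N /\ (1 < l)%N by lia.
exists (mkseq (fun i => (i.+1, l)) k); split; rewrite ?size_mkseq //.
- by move=> i ik; rewrite /xc /yc nth_mkseq.
- by left; rewrite /xc nth_mkseq.
- by move=> _; rewrite /xc /yc nth_mkseq //=; lia.
- move=> i /andP[i1 ik]; left; rewrite /xstep /xc /yc !nth_mkseq //=; last lia.
  by rewrite eqxx andbT; lia.
- by rewrite /xc /yc nth_mkseq /=; [congr (_, _)|]; lia.
Qed.

Lemma set_min_paths (k l : nat) (f : seq (nat * nat) -> R) :
  (1 <= k)%N -> (1 <= l)%N ->
  let m := set_min [set f P | P in paths_to k l]%classic in
  (exists2 P, paths_to k l P & f P = m) /\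
  (forall P, paths_to k l P -> m <= f P).
Proof.
move=> k1 l1 /=; have [ps Hps] := paths_to_cover k l.
have [P0 HP0] := paths_to_nonempty k1 l1.
set S := [set _ | _ in _]%classic.
suff ex : exists x, S x /\ lbound S x.
  have [Sm lm] := xgetPex 0 ex; split; first exact: Sm.
  by move=> P HP; apply: lm; exists P.
suff [P HP HPm] : exists2 P, paths_to k l P &
    forall Q, paths_to k l Q -> Q \in ps -> f P <= f Q.
  exists (f P); split; first by exists P.
  by move=> _ [Q HQ <-]; apply: HPm => //; exact: Hps.
elim: ps {Hps} => [|Q ps [P HP HPm]]; first by exists P0.
have [HQ|nHQ] := pselect (paths_to k l Q); last first.
  exists P => // Q' HQ'; rewrite in_cons => /orP[/eqP e|]; last exact: HPm.
  by rewrite e in HQ'.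
have [PQ|QP] := leP (f P) (f Q).
  by exists P => // Q' HQ'; rewrite in_cons => /orP[/eqP ->|] //; exact: HPm.
exists Q => // Q' HQ'; rewrite in_cons => /orP[/eqP ->|] // Q'ps.
by rewrite (le_trans (ltW QP)) // HPm.
Qed.

Lemma U_is_min (t : nat -> nat -> R) (k l : nat) :
  (1 <= k)%N -> (1 <= l)%N ->
  (exists2 P, paths_to k l P & red_weight t P = U t k l) /\
  (forall P, paths_to k l P -> U t k l <= red_weight t P).
Proof. exact: set_min_paths. Qed.

Lemma V_is_min (t : nat -> nat -> R) (k l : nat) :
  (1 <= k)%N -> (1 <= l)%N ->
  (exists2 P, paths_to k l P & blue_weight t P = V t k l) /\
  (forall P, paths_to k l P -> V t k l <= blue_weight t P).
Proof. exact: set_min_paths. Qed.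

End Weights.

(* A colouring of the edges of K_n is a map c on sets of vertices, of which   *)
(* only the values on 2-element sets are ever used: {u, v} is red if          *)
(* c [set u; v] = true, and blue otherwise.                                   *)
Definition colouring (n : nat) : Type := {set 'I_n} -> bool.

Definition red : bool := true.
Definition blue : bool := false.

Definition monochromatic (n : nat) (c : colouring n) (col : bool)
    (S : {set 'I_n}) : bool :=
  [forall u in S, forall v in S, (u != v) ==> (c [set u; v]%SET == col)].

Definition copies (n : nat) (c : colouring n) (col : bool) (k : nat) : nat :=
  #|[set S : {set 'I_n} | (#|S| == k) && monochromatic c col S]%SET|.

(* Main.v *)
Require Import Defs.
From mathcomp Require Import all_boot all_order all_algebra.
From mathcomp Require Import boolp classical_sets reals.
From mathcomp Require Import zify ring lra.

Set Implicit Arguments.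
Unset Strict Implicit.
Unset Printing Implicit Defensive.

Import Order.TTheory GRing.Theory Num.Theory.
Local Open Scope ring_scope.

(** Induction on k + l, proving the bound inside every vertex set W, with
    n^k / k! (n = #|W|) in place of 'C(n, k). Extending a minimal path by one
    step gives, with t = t_{k,l},
      U_{k,l} <= (1 - t)^k U_{k-1,l}  and  U_{k,l} <= t^k U_{k,l-1},
    and likewise for V with exponent l.
    Every vertex has red degree at least (1 - t)(n - 1) or blue degree at least
    t (n - 1). If the red neighbourhood of a vertex of the first kind already
    contains many blue K_l, or the blue neighbourhood of a vertex of the second
    kind many red K_k, we are done. Otherwise each vertex of the first kind lies
    in many red K_k and each one of the second kind in many blue K_l; since
    there are at least (1 - t) n of the first kind or t n of the second kind,
    double counting concludes. *)

(** * Nonnegativity and one-step recursion for the minimal weights *)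

Section Weights.
Variables (R : realType) (t : nat -> nat -> R).

(** The point of index 1 avoids the coordinate 1 and steps never decrease a coordinate. Hence
    weights evaluate [t] only where [threshold_sequence] constrains it. *)
Lemma path_interior_ge2 (k l : nat) (P : seq (nat * nat)) (i : nat) :
  paths_to k l P -> (0 < i < size P)%N -> (2 <= xc P i)%N && (2 <= yc P i)%N.
Proof.
move=> [_ lat _ lv st _]; case: i => // i /=; elim: i => [|i IH] iP.
  by have [] := lat _ iP; have [] := lv iP; lia.
have /andP[x2 y2] := IH (ltnW iP).
by case: (st i.+2 iP) => /andP[/eqP -> /eqP ->] /=; lia.
Qed.

Lemma path_s_ge0 (k l : nat) (P : seq (nat * nat)) (i : nat) :
  threshold_sequence t -> paths_to k l P -> (0 < i < size P)%N ->
  0 <= path_s t P i.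
Proof.
move=> ht hP iP; have /andP[x2 y2] := path_interior_ge2 hP iP.
have [/andP[t0 t1] _] := ht _ _ x2 y2.
by rewrite /path_s; case: ifP => _; rewrite ?subr_ge0 ltW.
Qed.

Lemma U_ge0 (k l : nat) :
  threshold_sequence t -> (1 <= k)%N -> (1 <= l)%N -> 0 <= U t k l.
Proof.
move=> ht k1 l1; have [[P hP <-] _] := U_is_min t k1 l1.
rewrite /red_weight big_nat; apply: prodr_ge0 => i iP.
exact/exprn_ge0/(path_s_ge0 ht hP).
Qed.

Lemma V_ge0 (k l : nat) :
  threshold_sequence t -> (1 <= k)%N -> (1 <= l)%N -> 0 <= V t k l.
Proof.
move=> ht k1 l1; have [[P hP <-] _] := V_is_min t k1 l1.
rewrite /blue_weight big_nat; apply: prodr_ge0 => i iP.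
exact/exprn_ge0/(path_s_ge0 ht hP).
Qed.

Lemma singleton_path (k l : nat) :
  (1 <= k)%N -> (1 <= l)%N -> k = 1%N \/ l = 1%N -> paths_to k l [:: (k, l)].
Proof.
move=> k1 l1 kl; split=> //=; first by case.
by case=> // i; rewrite ltnS ltn0 andbF.
Qed.

(** The one-point path has an empty product as its weight. *)
Lemma U_1l (l : nat) : (1 <= l)%N -> U t 1 l <= 1.
Proof.
move=> l1; have [_ /(_ [:: (1%N, l)])] := U_is_min t (leqnn 1) l1.
rewrite /red_weight big_geq //; apply; exact: singleton_path (or_introl _).
Qed.

Lemma V_k1 (k : nat) : (1 <= k)%N -> V t k 1 <= 1.
Proof.
move=> k1; have [_ /(_ [:: (k, 1%N)])] := V_is_min t k1 (leqnn 1).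
rewrite /blue_weight big_geq //; apply; exact: singleton_path (or_intror _).
Qed.

Definition lattice_step (p q : nat * nat) : bool :=
  (q == (p.1.+1, p.2)) || (q == (p.1, p.2.+1)).

Lemma xc_rcons (P : seq (nat * nat)) (q : nat * nat) (i : nat) :
  (i < size P)%N -> xc (rcons P q) i = xc P i.
Proof. by move=> iP; rewrite /xc nth_rcons iP. Qed.

Lemma yc_rcons (P : seq (nat * nat)) (q : nat * nat) (i : nat) :
  (i < size P)%N -> yc (rcons P q) i = yc P i.
Proof. by move=> iP; rewrite /yc nth_rcons iP. Qed.

Lemma xc_rcons_last (P : seq (nat * nat)) (q : nat * nat) :
  xc (rcons P q) (size P) = q.1.
Proof. by rewrite /xc nth_rcons ltnn eqxx. Qed.

Lemma yc_rcons_last (P : seq (nat * nat)) (q : nat * nat) :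
  yc (rcons P q) (size P) = q.2.
Proof. by rewrite /yc nth_rcons ltnn eqxx. Qed.

Lemma paths_to_rcons (k l k' l' : nat) (P : seq (nat * nat)) :
  (2 <= k')%N -> (2 <= l')%N -> lattice_step (k, l) (k', l') ->
  paths_to k l P -> paths_to k' l' (rcons P (k', l')).
Proof.
move=> k2 l2 stp [s0 lat sta lv st [ex ey]].
split; rewrite ?size_rcons //= ?xc_rcons_last ?yc_rcons_last //.
- move=> i; rewrite ltnS leq_eqVlt => /orP[/eqP ->|iP].
    by rewrite xc_rcons_last yc_rcons_last /=; lia.
  by rewrite xc_rcons ?yc_rcons //; exact: lat.
- by rewrite xc_rcons ?yc_rcons.
(* If [P] is a single point, the new point has index 1 and must avoid the coordinate 1; the bounds
   on [k'] and [l'] ensure this. *)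
- move=> _; case: (ltngtP 1 (size P)) => [s1|/=|s1]; last 1 first.
  + by rewrite s1 xc_rcons_last yc_rcons_last /=; lia.
  + by rewrite xc_rcons ?yc_rcons //; exact: lv.
  + lia.
- move=> i /andP[i0]; rewrite ltnS leq_eqVlt => /orP[/eqP ->|iP].
    have pP : ((size P).-1 < size P)%N by rewrite prednK.
    rewrite /xstep /ystep xc_rcons_last yc_rcons_last xc_rcons // yc_rcons //.
    by rewrite ex ey /=; apply/orP; move: stp; rewrite /lattice_step !xpair_eqE.
  have i'P : (i.-1 < size P)%N by lia.
  by rewrite /xstep /ystep !xc_rcons ?yc_rcons //; apply: st; rewrite i0.
Qed.

Lemma path_s_rcons (P : seq (nat * nat)) (q : nat * nat) (i : nat) :
  (0 < i < size P)%N -> path_s t (rcons P q) i = path_s t P i.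
Proof.
move=> /andP[i0 iP]; have i'P : (i.-1 < size P)%N by lia.
by rewrite /path_s /ystep !xc_rcons ?yc_rcons.
Qed.

Lemma red_weight_rcons (P : seq (nat * nat)) (q : nat * nat) :
  (0 < size P)%N ->
  red_weight t (rcons P q) =
  red_weight t P * path_s t (rcons P q) (size P) ^+ q.1.
Proof.
move=> s0; rewrite /red_weight size_rcons big_nat_recr //= xc_rcons_last.
congr (_ * _); apply: eq_big_nat => i /andP[i0 iP].
by rewrite path_s_rcons ?xc_rcons ?i0.
Qed.

Lemma blue_weight_rcons (P : seq (nat * nat)) (q : nat * nat) :
  (0 < size P)%N ->
  blue_weight t (rcons P q) =
  blue_weight t P * path_s t (rcons P q) (size P) ^+ q.2.
Proof.
move=> s0; rewrite /blue_weight size_rcons big_nat_recr //= yc_rcons_last.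
congr (_ * _); apply: eq_big_nat => i /andP[i0 iP].
by rewrite path_s_rcons ?yc_rcons ?i0.
Qed.

Lemma path_s_rcons_last (k l k' l' : nat) (P : seq (nat * nat)) :
  paths_to k l P ->
  path_s t (rcons P (k', l')) (size P) =
  if (k' == k) && (l' == l.+1) then t k' l' else 1 - t k' l'.
Proof.
move=> [s0 _ _ _ _ [ex ey]]; have pP : ((size P).-1 < size P)%N by rewrite prednK.
rewrite /path_s /ystep xc_rcons_last yc_rcons_last xc_rcons // yc_rcons //.
by rewrite ex ey.
Qed.

(** Append the step to a path of minimal weight to [(k, l)]. The [if] lets one statement serve both
    directions: a step up contributes [t], a step right [1 - t]. *)
Lemma U_step (k l k' l' : nat) :
  (1 <= k)%N -> (1 <= l)%N -> (2 <= k')%N -> (2 <= l')%N ->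
  lattice_step (k, l) (k', l') ->
  U t k' l' <=
  U t k l * (if (k' == k) && (l' == l.+1) then t k' l' else 1 - t k' l') ^+ k'.
Proof.
move=> k1 l1 k2 l2 stp; have [[P hP <-] _] := U_is_min t k1 l1.
have [_ /(_ _ (paths_to_rcons k2 l2 stp hP))] := U_is_min t (ltnW k2) (ltnW l2).
by rewrite red_weight_rcons ?(path_nonempty hP) // (path_s_rcons_last _ _ hP).
Qed.

Lemma V_step (k l k' l' : nat) :
  (1 <= k)%N -> (1 <= l)%N -> (2 <= k')%N -> (2 <= l')%N ->
  lattice_step (k, l) (k', l') ->
  V t k' l' <=
  V t k l * (if (k' == k) && (l' == l.+1) then t k' l' else 1 - t k' l') ^+ l'.
Proof.
move=> k1 l1 k2 l2 stp; have [[P hP <-] _] := V_is_min t k1 l1.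
have [_ /(_ _ (paths_to_rcons k2 l2 stp hP))] := V_is_min t (ltnW k2) (ltnW l2).
by rewrite blue_weight_rcons ?(path_nonempty hP) // (path_s_rcons_last _ _ hP).
Qed.

End Weights.

(** * The cost of replacing n - 1 by n in powers *)

(** Bernoulli's inequality for (1 - 1/x)^(k+1), scaled by x^(k+1). In the induction, multiplying by
    x - 1 leaves the surplus (k+1) x^k. *)
Lemma pow_pred_ge (R : realDomainType) (x : R) (k : nat) :
  1 <= x -> x ^+ k.+1 - k.+1%:R * x ^+ k <= (x - 1) ^+ k.+1.
Proof.
move=> x1; elim: k => [|k IH]; first by rewrite !expr1 expr0 mulr1.
rewrite [leRHS]exprS; apply: le_trans (ler_wpM2l _ IH); last by rewrite subr_ge0.
have xk : 0 <= x ^+ k by rewrite exprn_ge0 // (le_trans ler01).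
have -> : (x - 1) * (x ^+ k.+1 - k.+1%:R * x ^+ k) =
    x ^+ k.+2 - k.+2%:R * x ^+ k.+1 + k.+1%:R * x ^+ k.
  by rewrite !exprS -[k.+2%:R]natr1; ring.
by rewrite lerDl mulr_ge0.
Qed.

(** Meant for a neighbourhood of size x in a set of size n. As p^(k+1) <= 1, passing from n - 1 to n
    costs at most u (k+1) n^k, which joins the error term. *)
Lemma pow_pred_loss (R : realFieldType) (u A p x n : R) (k : nat) :
  0 <= u -> 0 <= A -> 0 <= p <= 1 -> 1 <= n -> p * (n - 1) <= x <= n ->
  u * p ^+ k.+1 * n ^+ k.+1 - (u * k.+1%:R + A) * n ^+ k <=
  u * x ^+ k.+1 - A * x ^+ k.
Proof.
move=> u0 A0 /andP[p0 p1] n1 /andP[px xn].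
have pn0 : 0 <= p * (n - 1) by rewrite mulr_ge0 ?subr_ge0.
have x0 := le_trans pn0 px.
have n0 : 0 <= n := le_trans ler01 n1.
have h1 : A * x ^+ k <= A * n ^+ k by rewrite ler_wpM2l // lerXn2r.
have h2 : u * (p * (n - 1)) ^+ k.+1 <= u * x ^+ k.+1.
  by rewrite ler_wpM2l // lerXn2r.
have h3 := ler_wpM2l (mulr_ge0 u0 (exprn_ge0 k.+1 p0)) (pow_pred_ge k n1).
have h4 : u * p ^+ k.+1 * (k.+1%:R * n ^+ k) <= u * (k.+1%:R * n ^+ k).
  rewrite -mulrA ler_wpM2l // ler_piMl ?exprn_ile1 //.
  by rewrite mulr_ge0 ?exprn_ge0.
move: h2 h3 h4; rewrite exprMn !mulrBr; lra.
Qed.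

(** * Monochromatic cliques inside a vertex set, and double counting *)

Section Colourings.
Variables (n : nat) (c : colouring n).
Implicit Types (W S : {set 'I_n}) (v w : 'I_n) (col : bool) (k : nat).

Definition cliques col k W : {set {set 'I_n}} :=
  [set S : {set 'I_n} | [&& S \subset W, #|S| == k & monochromatic c col S]].

Definition nbhd col W v : {set 'I_n} :=
  [set w in W | (w != v) && (c [set v; w]%SET == col)].

Lemma copiesE col k : copies c col k = #|cliques col k [set: 'I_n]|.
Proof. by rewrite /copies; apply: eq_card => S; rewrite !inE finset.subsetT. Qed.

Lemma leq_cliques col k W S :
  S \subset W -> (#|cliques col k S| <= #|cliques col k W|)%N.
Proof.
move=> SW; apply/subset_leq_card/fintype.subsetP => X; rewrite !inE.
by case/and3P => XS -> ->; rewrite (fintype.subset_trans XS).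
Qed.

Lemma nbhd_sub col W v : nbhd col W v \subset W.
Proof. by apply/fintype.subsetP => w; rewrite inE => /andP[]. Qed.

Lemma card_nbhd W v :
  v \in W -> (#|nbhd red W v| + #|nbhd blue W v|).+1 = #|W|.
Proof.
move=> vW; rewrite [RHS](cardsD1 v) vW add1n; congr _.+1.
rewrite -(cardsID (nbhd red W v) (W :\ v)); congr (_ + _)%N; apply: eq_card => w.
  by rewrite !inE; case: (w == v); case: (w \in W); case: (c _).
by rewrite !inE; case: (w == v); case: (w \in W); case: (c _).
Qed.

Lemma card_cliques1 col W : (#|W| <= #|cliques col 1 W|)%N.
Proof.
rewrite -(card_imset (mem W) (@set1_inj _)).
apply/subset_leq_card/fintype.subsetP => _ /imsetP[v vW ->].
rewrite inE finset.sub1set vW cards1 /=.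
apply/forall_inP => u; rewrite inE => /eqP ->.
by apply/forall_inP => w; rewrite inE => /eqP ->; rewrite eqxx.
Qed.

Lemma cliques_nbhd_extend col k W v S :
  v \in W -> S \in cliques col k (nbhd col W v) ->
  v \notin S /\ v |: S \in cliques col k.+1 W.
Proof.
move=> vW; rewrite !inE => /and3P[/fintype.subsetP SN /eqP kS /forall_inP mS].
have vS : v \notin S.
  by apply/negP => /SN; rewrite inE eqxx andbF.
split=> //; apply/and3P; split.
- rewrite finset.subUset finset.sub1set vW; apply/fintype.subsetP => w /SN.
  by rewrite inE => /andP[].
- by rewrite cardsU1 vS kS.
- apply/forall_inP => x; rewrite in_setU1 => xS.
  apply/forall_inP => y; rewrite in_setU1 => yS; apply/implyP => xy.
  case/orP: xS xy => [/eqP ->|xS]; case/orP: yS => [/eqP ->|yS] xy.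
  + by rewrite eqxx in xy.
  + by have := SN _ yS; rewrite inE => /and3P[].
  + by have := SN _ xS; rewrite inE finset.setUC => /and3P[].
  + by have /forall_inP/(_ y yS)/implyP := mS _ xS; apply.
Qed.

(** Double counting of pairs (v, X) with v in X: each X has k + 1 vertices, and for fixed v, adding
    v maps the k-cliques of its neighbourhood injectively to (k+1)-cliques containing v. *)
Lemma sum_cliques_nbhd col k W S :
  S \subset W ->
  (\sum_(v in S) #|cliques col k (nbhd col W v)|
     <= k.+1 * #|cliques col k.+1 W|)%N.
Proof.
move=> SW.
have -> : (k.+1 * #|cliques col k.+1 W| =
    \sum_(X in cliques col k.+1 W) \sum_(v in X) 1)%N.
  rewrite mulnC -sum_nat_const; apply: eq_bigr => X.
  by rewrite inE sum1_card => /and3P[_ /eqP ->].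
rewrite (exchange_big_dep predT) //= [leqLHS]big_mkcond /=.
apply: leq_sum => v _; case: ifP => // vS; rewrite sum1_card.
rewrite -(@card_in_imset _ _ (fun X => v |: X) (mem (cliques col k (nbhd col W v)))).
  apply/subset_leq_card/fintype.subsetP => _ /imsetP[X XN ->].
  have [_ ?] := cliques_nbhd_extend (fintype.subsetP SW _ vS) XN.
  by rewrite unfold_in /= setU11 andbT.
move=> X Y XN YN e.
have [vX _] := cliques_nbhd_extend (fintype.subsetP SW _ vS) XN.
have [vY _] := cliques_nbhd_extend (fintype.subsetP SW _ vS) YN.
by rewrite -(setU1K vX) e setU1K.
Qed.

End Colourings.

(** * Clique bounds with error terms, and the induction *)

Section Counting.
Variable R : realType.
Implicit Types (a A p : R) (n k : nat).

(** Stated for any vertex set, so that the induction can enter neighbourhoods. The density [a] will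
    be U or V divided by a factorial. *)
Definition many n (c : colouring n) (col : bool) a A k (W : {set 'I_n}) : Prop :=
  a * #|W|%:R ^+ k - A * #|W|%:R ^+ (k - 1) <= #|cliques c col k W|%:R.

Lemma many_weaken n (c : colouring n) col a a' A A' k (W : {set 'I_n}) :
  a' <= a -> A <= A' -> many c col a A k W -> many c col a' A' k W.
Proof.
move=> aa AA; apply: le_trans; apply: lerB; apply: ler_wpM2r => //;
  exact: exprn_ge0.
Qed.

Lemma many1 n (c : colouring n) col a A (W : {set 'I_n}) :
  a <= 1 -> 0 <= A -> many c col a A 1 W.
Proof.
move=> a1 A0; apply: (@many_weaken _ _ _ 1 _ 0) => //.
by rewrite /many mul1r mul0r subr0 expr1 ler_nat card_cliques1.
Qed.

Lemma many_set0 n (c : colouring n) col a A k (W : {set 'I_n}) :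
  (0 < k)%N -> 0 <= A -> #|W| = 0%N -> many c col a A k W.
Proof.
move=> k0 A0 W0; rewrite /many W0 expr0n gtn_eqF // mulr0 sub0r.
by apply: le_trans (ler0n _ _); rewrite oppr_le0 mulr_ge0 ?exprn_ge0.
Qed.

(** The cliques inside [N] alone suffice; shrinking to a proportion p of the vertices costs the
    factor p^(k+1). *)
Lemma many_subset n (c : colouring n) col a A p k (W N : {set 'I_n}) :
  0 <= a -> 0 <= A -> 0 <= p <= 1 -> (0 < #|W|)%N -> N \subset W ->
  p * (#|W|%:R - 1) <= #|N|%:R -> many c col a A k.+1 N ->
  many c col (a * p ^+ k.+1) (a * k.+1%:R + A) k.+1 W.
Proof.
move=> a0 A0 p01 W0 NW pN; rewrite /many subn1 /= => hN.
have le1 : 1 <= #|W|%:R :> R by rewrite ler1n.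
have := @pow_pred_loss R a A p #|N|%:R _ k a0 A0 p01 le1.
rewrite pN ler_nat subset_leq_card // => /(_ isT) h.
apply: le_trans h _; apply: le_trans hN _.
by rewrite ler_nat leq_cliques.
Qed.

(** Summing over the centres in [S] counts each (k+2)-clique at most k + 2 times, hence the
    division. The exponent k + 2 combines k + 1 from the neighbourhoods with one more factor p from
    the proportion of centres. *)
Lemma many_star n (c : colouring n) col a A p k (W S : {set 'I_n}) :
  0 <= a -> 0 <= A -> 0 <= p <= 1 -> (0 < #|W|)%N -> S \subset W ->
  p * #|W|%:R <= #|S|%:R ->
  (forall v, v \in S -> p * (#|W|%:R - 1) <= #|nbhd c col W v|%:R /\
    many c col a A k.+1 (nbhd c col W v)) ->
  many c col (a * p ^+ k.+2 / k.+2%:R) (a * k.+1%:R + A) k.+2 W.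
Proof.
move=> a0 A0 p01 W0 SW pS hS; rewrite /many subn1 /=.
have le1 : 1 <= #|W|%:R :> R by rewrite ler1n.
have p0 : 0 <= p by case/andP: p01.
set N : R := #|W|%:R in le1 pS hS *.
have N0 : 0 <= N by rewrite (le_trans ler01).
set B := a * k.+1%:R + A; have B0 : 0 <= B by rewrite addr_ge0 ?mulr_ge0.
set x : R := a * p ^+ k.+1 * N ^+ k.+1.
have x0 : 0 <= x by rewrite !mulr_ge0 ?exprn_ge0.
have hv v : v \in S ->
    x - B * N ^+ k <= #|cliques c col k.+1 (nbhd c col W v)|%:R.
  move=> /hS[pd]; rewrite /many subn1 /= => hN; apply: le_trans hN.
  apply: pow_pred_loss => //.
  by rewrite pd ler_nat subset_leq_card ?nbhd_sub.
have hsum : #|S|%:R * (x - B * N ^+ k) <= k.+2%:R * #|cliques c col k.+2 W|%:R.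
  apply: (@le_trans _ _ (\sum_(v in S) #|cliques c col k.+1 (nbhd c col W v)|)%N%:R).
    by rewrite natr_sum mulr_natl -sumr_const; exact: ler_sum.
  by rewrite -natrM ler_nat sum_cliques_nbhd.
have S1 : #|S|%:R <= N by rewrite ler_nat subset_leq_card.
(* As [x - B * N ^+ k] may be negative, the main term uses the lower bound on [#|S|] and the loss
   uses the upper one. *)
have h1 := ler_wpM2r x0 pS.
have h2 := ler_wpM2r (mulr_ge0 B0 (exprn_ge0 k N0)) S1.
(* The spare factor k + 2 keeps the error constant equal to [B] after the final division. *)
have h3 : N * (B * N ^+ k) <= k.+2%:R * (B * N ^+ k.+1).
  rewrite exprS mulrCA ler_peMl ?mulr_ge0 ?exprn_ge0 //.
  by rewrite ler1n.
rewrite -(@ler_pM2l _ k.+2%:R) ?ltr0n //; apply: le_trans hsum.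
have -> : k.+2%:R * (a * p ^+ k.+2 / k.+2%:R * N ^+ k.+2 - B * N ^+ k.+1) =
    p * N * x - k.+2%:R * (B * N ^+ k.+1).
  have : k.+2%:R != 0 :> R by rewrite pnatr_eq0.
  rewrite /x mulrBr ![_ ^+ k.+2]exprS; move: k.+2%:R => K K0.
  by congr (_ - _); field.
rewrite mulrBr; lra.
Qed.

(* [ur], [vr] are the densities for the red neighbourhoods, i.e. for the index *)
(* (k - 1, l), and [ub], [vb] those for the blue ones, i.e. for (k, l - 1).    *)
Lemma many_step n (c : colouring n) p k l (W : {set 'I_n})
    (ur vr ub vb A : R) :
  0 <= p <= 1 -> 0 <= ur -> 0 <= vr -> 0 <= ub -> 0 <= vb -> 0 <= A ->
  (forall N : {set 'I_n},
     many c red ur A k.+1 N \/ many c blue vr A l.+2 N) ->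
  (forall N : {set 'I_n},
     many c red ub A k.+2 N \/ many c blue vb A l.+1 N) ->
  [\/ many c red (ur * p ^+ k.+2 / k.+2%:R) (ur * k.+1%:R + A) k.+2 W,
      many c red (ub * (1 - p) ^+ k.+2) (ub * k.+2%:R + A) k.+2 W,
      many c blue (vr * p ^+ l.+2) (vr * l.+2%:R + A) l.+2 W |
      many c blue (vb * (1 - p) ^+ l.+2 / l.+2%:R) (vb * l.+1%:R + A) l.+2 W].
Proof.
move=> p01 ur0 vr0 ub0 vb0 A0 hr hb.
have [W0|Wpos] := posnP #|W|.
  by constructor 1; apply: many_set0; rewrite ?addr_ge0 ?mulr_ge0.
have q01 : 0 <= 1 - p <= 1 by lra.
pose big v := p * (#|W|%:R - 1) <= #|nbhd c red W v|%:R.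
(* The two degrees of [v] add up to [#|W| - 1], so a red degree below its share forces a large blue
   one. *)
have bigN v : v \in W -> ~~ big v ->
    (1 - p) * (#|W|%:R - 1) <= #|nbhd c blue W v|%:R.
  move=> vW; rewrite /big -ltNge -(card_nbhd c vW) -natr1 natrD; lra.
have [[v [vW bv hv]]|nr] := pselect (exists v,
    [/\ v \in W, big v & many c blue vr A l.+2 (nbhd c red W v)]).
  by constructor 3; exact: (many_subset _ _ _ _ (nbhd_sub _ _ _ _) bv).
have [[v [vW bv hv]]|nb] := pselect (exists v,
    [/\ v \in W, ~~ big v & many c red ub A k.+2 (nbhd c blue W v)]).
  constructor 2.
  exact: (many_subset _ _ _ _ (nbhd_sub _ _ _ _) (bigN _ vW bv)).
(* By [nr] and [nb], each large neighbourhood now has many cliques one vertex smaller in the colour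
   joining it to its centre, so they extend by the centre. *)
pose S := [set v in W | big v].
have SW : S \subset W by apply/fintype.subsetP => v; rewrite inE => /andP[].
have [pS|Sp] := leP (p * #|W|%:R) #|S|%:R.
  constructor 1; apply: (many_star _ _ _ _ SW pS) => // v.
  rewrite inE => /andP[vW bv]; split=> //.
  by case: (hr (nbhd c red W v)) => // ?; case: nr; exists v.
constructor 4; apply: (@many_star _ _ _ _ _ _ _ _ (W :\: S)) => //.
- exact: finset.subsetDl.
- by move: Sp; rewrite -(cardsID S W) (finset.setIidPr SW) natrD; lra.
- move=> v; rewrite !inE => /andP[nv vW].
  have bv : ~~ big v by rewrite vW in nv.
  split; first exact: bigN.
  by case: (hb (nbhd c blue W v)) => // ?; case: nb; exists v.
Qed.

(** [A] is chosen before [n], [c] and [W], so the induction hypotheses apply to all neighbourhoods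
    with the same constant. The indices are shifted to make both clique sizes positive. *)
Lemma many_cliques (t : nat -> nat -> R) k l :
  threshold_sequence t ->
  exists2 A, 0 <= A & forall n (c : colouring n) (W : {set 'I_n}),
    many c red (U t k.+1 l.+1 / k.+1`!%:R) A k.+1 W \/
    many c blue (V t k.+1 l.+1 / l.+1`!%:R) A l.+1 W.
Proof.
move=> ht; move: {2}(k + l)%N (leqnn (k + l)) => s.
elim: s k l => [|s IH] [|k] l => [_|//|_|kl].
- by exists 0 => // n c W; left; apply: many1; rewrite ?divr1 ?U_1l.
- by exists 0 => // n c W; left; apply: many1; rewrite ?divr1 ?U_1l.
case: l kl => [_|l kl].
  by exists 0 => // n c W; right; apply: many1; rewrite ?divr1 ?V_k1.
have [|Ar Ar0 hr] := IH k l.+1; first lia.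
have [|Ab Ab0 hb] := IH k.+1 l; first lia.
have [/andP[t0 t1] _] := ht k.+2 l.+2 isT isT.
(* [p] is the factor of a step right into [(k.+2, l.+2)], and [1 - p] that of a step up. *)
set p := 1 - t k.+2 l.+2.
have tE : t k.+2 l.+2 = 1 - p by rewrite /p; ring.
have p01 : 0 <= p <= 1 by rewrite /p; lra.
set ur := U t k.+1 l.+2 / k.+1`!%:R; set vr := V t k.+1 l.+2 / l.+2`!%:R.
set ub := U t k.+2 l.+1 / k.+2`!%:R; set vb := V t k.+2 l.+1 / l.+1`!%:R.
have ur0 : 0 <= ur by rewrite divr_ge0 ?U_ge0.
have vr0 : 0 <= vr by rewrite divr_ge0 ?V_ge0.
have ub0 : 0 <= ub by rewrite divr_ge0 ?U_ge0.
have vb0 : 0 <= vb by rewrite divr_ge0 ?V_ge0.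
have fU (m : nat) (x y : R) : x <= y -> x / m`!%:R <= y / m`!%:R.
  by move=> xy; rewrite ler_wpM2r ?invr_ge0.
(* The division by k + 2 from double counting turns (k+1)! into (k+2)!. In [Ub] and [Vr] the clique
   size does not change, so neither does the factorial. *)
have Ur : U t k.+2 l.+2 / k.+2`!%:R <= ur * p ^+ k.+2 / k.+2%:R.
  have := @U_step R t k.+1 l.+2 k.+2 l.+2 isT isT isT isT.
  rewrite /lattice_step eqxx gtn_eqF //= => /(_ isT)/(fU k.+2) h.
  apply: le_trans h _; rewrite /ur factS natrM -/p invfM [_^-1 * _]mulrC.
  by rewrite mulrA (mulrAC (U _ _ _)).
have Ub : U t k.+2 l.+2 / k.+2`!%:R <= ub * (1 - p) ^+ k.+2.
  have := @U_step R t k.+2 l.+1 k.+2 l.+2 isT isT isT isT.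
  rewrite /lattice_step !eqxx orbT /= => /(_ isT)/(fU k.+2) h.
  by apply: le_trans h _; rewrite /ub tE mulrAC.
have Vr : V t k.+2 l.+2 / l.+2`!%:R <= vr * p ^+ l.+2.
  have := @V_step R t k.+1 l.+2 k.+2 l.+2 isT isT isT isT.
  rewrite /lattice_step eqxx gtn_eqF //= => /(_ isT)/(fU l.+2) h.
  by apply: le_trans h _; rewrite /vr -/p mulrAC.
have Vb : V t k.+2 l.+2 / l.+2`!%:R <= vb * (1 - p) ^+ l.+2 / l.+2%:R.
  have := @V_step R t k.+2 l.+1 k.+2 l.+2 isT isT isT isT.
  rewrite /lattice_step !eqxx orbT /= => /(_ isT)/(fU l.+2) h.
  apply: le_trans h _; rewrite /vb factS natrM tE invfM [_^-1 * _]mulrC.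
  by rewrite mulrA (mulrAC (V _ _ _)).
have mulk (x : R) (m : nat) : 0 <= x -> 0 <= x * m%:R.
  by move=> ?; rewrite mulr_ge0.
have e1 := mulk _ k.+1 ur0; have e2 := mulk _ k.+2 ub0.
have e3 := mulk _ l.+2 vr0; have e4 := mulk _ l.+1 vb0.
(* This dominates the error constants of all four outcomes of [many_step], every summand being
   nonnegative. *)
exists (ur * k.+1%:R + ub * k.+2%:R + vr * l.+2%:R + vb * l.+1%:R + (Ar + Ab)).
  by rewrite !addr_ge0.
move=> n c W.
have hr' (N : {set 'I_n}) :
    many c red ur (Ar + Ab) k.+1 N \/ many c blue vr (Ar + Ab) l.+2 N.
  have [h|h] := hr n c N; [left|right]; apply: many_weaken h => //; lra.
have hb' (N : {set 'I_n}) :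
    many c red ub (Ar + Ab) k.+2 N \/ many c blue vb (Ar + Ab) l.+1 N.
  have [h|h] := hb n c N; [left|right]; apply: many_weaken h => //; lra.
have [] := many_step W p01 ur0 vr0 ub0 vb0 (addr_ge0 Ar0 Ab0) hr' hb' => h;
  [left|left|right|right]; apply: many_weaken h => //; lra.
Qed.

End Counting.

(** * From powers to binomial coefficients, and the conclusion *)

(** The left side is a falling factorial, a product of k factors each at most n. *)
Lemma bin_le_expn_fact (n k : nat) : ('C(n, k) * k`! <= n ^ k)%N.
Proof.
rewrite bin_ffact ffact_prod -[k in leqRHS]card_ord -prod_nat_const.
by apply: leq_prod => i _; exact: leq_subr.
Qed.

Lemma le_bin_expn_fact (R : realFieldType) (n k : nat) (a : R) :
  0 <= a -> a * 'C(n, k)%:R <= a / k`!%:R * n%:R ^+ k.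
Proof.
move=> a0; rewrite -mulrA ler_wpM2l // mulrC ler_pdivlMr ?ltr0n ?fact_gt0 //.
by rewrite -natrM -natrX ler_nat bin_le_expn_fact.
Qed.

Theorem theorem3 (R : realType) (k l : nat) (hk : (1 <= k)%N) (hl : (1 <= l)%N)
    (t : nat -> nat -> R) (ht : threshold_sequence t) :
  exists A : R, forall (n : nat) (c : colouring n),
    U t k l * 'C(n, k)%:R - A * n%:R ^+ (k - 1) <= (copies c red k)%:R \/
    V t k l * 'C(n, l)%:R - A * n%:R ^+ (l - 1) <= (copies c blue l)%:R.
Proof.
case: k hk => // k _; case: l hl => // l _.
have [A A0 hA] := many_cliques k l ht; exists A => n c.
have [h|h] := hA n c [set: 'I_n]%SET; [left|right]; move: h;
  rewrite copiesE /many cardsT card_ord; apply: le_trans;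
  by rewrite lerB // le_bin_expn_fact ?U_ge0 ?V_ge0.
Qed.
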